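(* For $k\in\mathbb{N}$ let $c_k=\dfrac{3\,|B_{2k}|\,(2^{2k}-2)+(-1)^{k}}{(2k)!}$, where $B_{2k}$ denotes the Bernoulli number. For every $x\in(0,\pi/2)$ and every integer $m\ge 3$, $$4+\sum_{k=1}^{m-1}c_k x^{2k}+\Big(\frac{2x}{\pi}\Big)^{2m}\Big(\frac{3\pi}{2}-4-\sum_{k=1}^{m-1}c_k\Big(\frac{\pi}{2}\Big)^{2k}\Big)>3\,\frac{x}{\sin x}+\cos x>4+\sum_{k=1}^{m}c_k x^{2k}.$$
   Context: $B_j$ are the Bernoulli numbers ($B_2=1/6$, $B_4=-1/30$, $B_6=1/42,\dots$). The quantity $3\pi/2$ is the value at $x=\pi/2$ of $3x/\sin x+\cos x$. *)

(* Defs.v *)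
From Stdlib Require Import Arith Reals Lra Lia List.
Open Scope R_scope.

(* Bernoulli numbers via the standard recursion
   B_0 = 1,  B_n = -1/(n+1) * sum_{k=0}^{n-1} C(n+1,k) B_k  (so B_1 = -1/2).
   bern_upto n is the list [B_0; ...; B_n]. *)
Fixpoint bern_upto (n : nat) : list R :=
  match n with
  | O => 1 :: nil
  | S n' =>
      let l := bern_upto n' in
      l ++ (- / (INR n + 1) *
              sum_f_R0 (fun k => C (S n) k * nth k l 0) n') :: nil
  end.

Definition bernoulli (n : nat) : R := nth n (bern_upto n) 0.

Definition c (k : nat) : R :=
  (3 * Rabs (bernoulli (2 * k)) * (2 ^ (2 * k) - 2) + (-1) ^ k)
  / INR (fact (2 * k)).

Fixpoint csum (n : nat) (x : R) : R :=
  match n with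
  | O => 0
  | S n' => csum n' x + c n * x ^ (2 * n)
  end.

(* Main.v *)
(** Let [G(t) = t / (e^t - 1) = sum B_n t^n / n!].  The odd coefficients of
    [G(t) (e^(t/2) - e^(-t/2)) = t e^(-t/2)] say, after substituting [t = 2 i x],
    that the numbers [u_k = (-4)^k B_{2k} / (2k)!] are the coefficients of
    [U(y) = x cot x] in [y = x^2].  Differentiating [U(x^2) sin x = x cos x] gives
    the Riccati equation [2 y U' + U^2 = U - y], hence with [b_k = - u_k] one has
    [b_1 = 1/3] and [(2k+1) b_k = sum_{0<i<k} b_i b_{k-i}] for [k >= 2].
    Therefore [0 < b_k <= 2 / 6^k] and the series converges for [x^2 < 6], which
    includes [x = pi/2].  As [x / sin x = 2 (x/2) cot (x/2) - x cot x], the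
    [c_k] are the coefficients of [3 x / sin x + cos x].  The recursion
    also gives [3/2 b_k >= 1 / (2k)!] for [k >= 3], so [c_k > 0] there: the lower
    bound drops a positive tail, and the upper bound holds because the tail
    divided by [x^(2m)] is increasing. *)

Require Import Defs.
From Stdlib Require Import Arith Reals Lra Lia List.
From Coquelicot Require Import Coquelicot.
Open Scope R_scope.

(** * Power series *)

Lemma sum_f_R0_even_terms (f : nat -> R) (n : nat) :
  (forall k, f (S (2 * k)) = 0) ->
  sum_f_R0 f (S (2 * n)) = sum_f_R0 (fun k => f (2 * k)%nat) n.
Proof.
intros Hf; induction n as [|n IH]; [rewrite tech5, (Hf 0%nat); simpl; ring|].
replace (S (2 * S n)) with (S (S (S (2 * n)))) by lia.
rewrite !(tech5 _ (S _)), IH, tech5.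
replace (S (S (2 * n))) with (2 * S n)%nat by lia.
rewrite Hf; ring.
Qed.

Lemma CV_radius_ge_of_bounded (a : nat -> R) (r M : R) :
  (forall n, Rabs (a n * r ^ n) <= M) -> Rbar_le r (CV_radius a).
Proof.
intros Ha; apply (proj1 (CV_radius_bounded a)).
now exists M.
Qed.

Lemma CV_radius_ge_of_ex_pseries (a : nat -> R) (x : R) :
  ex_pseries a x -> Rbar_le (Rabs x) (CV_radius a).
Proof.
intros H.
destruct (Rbar_le_lt_dec (Rabs x) (CV_radius a)) as [|Hlt]; [assumption|].
exfalso; apply (CV_disk_outside a x Hlt).
apply ex_series_lim_0, (proj1 (ex_pseries_R a x)), H.
Qed.

Lemma ex_pseries_Rabs_lt (a : nat -> R) (y z : R) :
  Rabs y < Rabs z -> ex_pseries a z -> ex_pseries a y.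
Proof.
intros Hyz Ez.
apply CV_radius_inside, Rbar_lt_le_trans with (Finite (Rabs z)); [exact Hyz|].
now apply CV_radius_ge_of_ex_pseries.
Qed.

Lemma CV_radius_infinite (a : nat -> R) :
  (forall x, ex_pseries a x) -> CV_radius a = p_infty.
Proof.
intros H.
pose proof (fun x => CV_radius_ge_of_ex_pseries a x (H x)) as Hge.
destruct (CV_radius a) as [r| |]; [|reflexivity|now specialize (Hge 0)].
specialize (Hge (r + 1)); simpl in Hge.
pose proof (Rle_abs (r + 1)); lra.
Qed.

Lemma locally_lt_CV_radius (a : nat -> R) (x : R) :
  Rbar_lt (Rabs x) (CV_radius a) ->
  locally x (fun t => Rbar_lt (Rabs t) (CV_radius a)).
Proof.
intros Hx.
exact (continuous_Rabs x (fun r => Rbar_lt r (CV_radius a))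
         (open_Rbar_lt (CV_radius a) (Rabs x) Hx)).
Qed.

Lemma is_pseries_coef_unique (a b : nat -> R) (f : R -> R) (n : nat) :
  locally 0 (fun t => is_pseries a t (f t)) ->
  locally 0 (fun t => is_pseries b t (f t)) -> a n = b n.
Proof.
intros Ha Hb.
assert (radius_pos : forall c, locally 0 (fun t => is_pseries c t (f t)) ->
  Rbar_lt 0 (CV_radius c)).
{ intros c [d Hd].
  apply Rbar_lt_le_trans with (Finite (Rabs (d / 2))).
  - pose proof (cond_pos d); simpl; rewrite Rabs_pos_eq; lra.
  - apply CV_radius_ge_of_ex_pseries; exists (f (d / 2)); apply Hd.
    pose proof (cond_pos d).
    change (Rabs (d / 2 - 0) < d); rewrite Rabs_pos_eq; lra. }
apply PSeries_ext_recip; [now apply radius_pos..|].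
generalize (filter_and _ _ Ha Hb); apply filter_imp.
intros t [Hat Hbt].
now rewrite (is_pseries_unique _ _ _ Hat), (is_pseries_unique _ _ _ Hbt).
Qed.

Definition PS_one (n : nat) : R := match n with O => 1 | S _ => 0 end.

Lemma is_pseries_one (x : R) : is_pseries PS_one x 1.
Proof.
apply is_pseries_R.
apply is_series_ext with (fun n => 0 ^ n).
- intros [|n]; simpl; ring.
- replace 1 with (/ (1 - 0)) by field.
  apply is_series_geom; rewrite Rabs_R0; lra.
Qed.

Lemma PS_incr_1_derive (a : nat -> R) (n : nat) :
  PS_incr_1 (PS_derive a) n = INR n * a n.
Proof.
destruct n as [|n]; [simpl; now rewrite Rmult_0_l|reflexivity].
Qed.

Lemma PS_mult_self_SS (a : nat -> R) (n : nat) :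
  PS_mult a a (S (S n))
  = 2 * a 0%nat * a (S (S n)) + PS_mult (PS_decr_1 a) (PS_decr_1 a) n.
Proof.
unfold PS_mult.
rewrite decomp_sum by lia; simpl pred.
rewrite tech5, Nat.sub_0_r, Nat.sub_diag.
rewrite (sum_eq (fun i => a (S i) * a (S (S n) - S i)%nat)
           (fun k => PS_decr_1 a k * PS_decr_1 a (n - k)%nat)).
- ring.
- intros i Hi; unfold PS_decr_1.
  now replace (S (S n) - S i)%nat with (S (n - i)) by lia.
Qed.

(* The geometric sum of the (2 r)^k r^(n-k) over k < n stays below (2 r)^n. *)
Lemma Rabs_PS_inverse_le (a b : nat -> R) (r : R) :
  b 0%nat = 1 -> (forall n, Rabs (b n) <= r ^ n) ->
  (forall n, PS_mult a b n = PS_one n) -> forall n, Rabs (a n) <= (2 * r) ^ n.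
Proof.
intros Hb0 Hb Hab n.
assert (Hr : 0 <= r).
{ pose proof (Hb 1%nat); pose proof (Rabs_pos (b 1%nat)); simpl in *; lra. }
induction n as [n IH] using lt_wf_ind.
pose proof (Hab n) as H; unfold PS_mult in H.
destruct n as [|n].
- simpl in *; rewrite Hb0, Rmult_1_r in H.
  rewrite H, Rabs_R1; lra.
- rewrite tech5, Nat.sub_diag, Hb0 in H; unfold PS_one in H.
  replace (a (S n)) with (- sum_f_R0 (fun k => a k * b (S n - k)%nat) n) by lra.
  rewrite Rabs_Ropp.
  apply Rle_trans with (sum_f_R0 (fun k => 2 ^ k * r ^ S n) n).
  + eapply Rle_trans; [apply Rsum_abs|].
    apply sum_Rle; intros k Hk; rewrite Rabs_mult.
    replace (2 ^ k * r ^ S n) with ((2 * r) ^ k * r ^ (S n - k)).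
    * apply Rmult_le_compat; try apply Rabs_pos; [apply IH; lia|apply Hb].
    * rewrite Rpow_mult_distr, Rmult_assoc, <- pow_add; do 2 f_equal; lia.
  + rewrite <- scal_sum, tech3, Rpow_mult_distr by lra.
    pose proof (pow_le r (S n) Hr).
    replace ((1 - 2 ^ S n) / (1 - 2)) with (2 ^ S n - 1) by field; lra.
Qed.

Lemma Series_pos (a : nat -> R) (k : nat) :
  (forall n, 0 <= a n) -> 0 < a k -> ex_series a -> 0 < Series a.
Proof.
intros Ha Hk E.
apply Rlt_le_trans with (sum_f_R0 a k).
- destruct k as [|k]; [exact Hk|].
  rewrite tech5; pose proof (cond_pos_sum a k Ha); lra.
- apply sum_incr; [|exact Ha].
  now apply is_series_Reals, Series_correct.
Qed.

Lemma PSeries_pos (a : nat -> R) (y : R) :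
  (forall n, 0 <= a n) -> 0 < a 0%nat -> 0 <= y -> ex_pseries a y ->
  0 < PSeries a y.
Proof.
intros Ha Ha0 Hy E.
apply (Series_pos _ 0).
- intros n; apply Rmult_le_pos; [apply Ha|now apply pow_le].
- simpl; lra.
- now apply ex_pseries_R.
Qed.

Lemma PSeries_increasing (a : nat -> R) (y z : R) :
  (forall n, 0 <= a n) -> 0 < a 1%nat -> 0 <= y < z -> ex_pseries a z ->
  PSeries a y < PSeries a z.
Proof.
intros Ha Ha1 [Hy Hyz] Ez.
assert (Ey : ex_pseries a y)
  by (apply (ex_pseries_Rabs_lt a y z); [rewrite !Rabs_pos_eq; lra|exact Ez]).
apply ex_pseries_R in Ey; apply ex_pseries_R in Ez.
apply Rminus_lt_0; unfold PSeries; rewrite <- Series_minus by assumption.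
apply (Series_pos _ 1).
- intros n; rewrite <- Rmult_minus_distr_l.
  apply Rmult_le_pos; [apply Ha|].
  pose proof (pow_incr y z n); lra.
- simpl; nra.
- now apply (ex_series_minus (V := R_NormedModule)).
Qed.

Lemma ex_pseries_decr_n_R (a : nat -> R) (n : nat) (y : R) :
  ex_pseries a y -> ex_pseries (PS_decr_n a n) y.
Proof.
apply ex_pseries_decr_n.
destruct (Req_dec y 0) as [->|Hy]; [now left|right].
exists (/ y); now apply Rinv_l.
Qed.

Definition PS_partial_sum (a : nat -> R) (n : nat) (y : R) : R :=
  sum_f_R0 (fun k => a k * y ^ k) n.

Section TruncatedPositiveSeries.

Variables (a : nat -> R) (n : nat).
Hypothesis coef_pos : forall k, (n < k)%nat -> 0 < a k.

Lemma PS_decr_n_pos (k : nat) : 0 < PS_decr_n a (S n) k.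
Proof. apply coef_pos; lia. Qed.

Lemma PS_partial_sum_lt_PSeries (y : R) :
  0 < y -> ex_pseries a y -> PS_partial_sum a n y < PSeries a y.
Proof.
intros Hy E; rewrite (PSeries_decr_n a n y E); fold (PS_partial_sum a n y).
assert (0 < y ^ S n * PSeries (PS_decr_n a (S n)) y); [|lra].
apply Rmult_lt_0_compat; [now apply pow_lt|].
apply PSeries_pos; [intros k; left; apply PS_decr_n_pos|apply PS_decr_n_pos|lra|].
now apply ex_pseries_decr_n_R.
Qed.

(* The tail divided by y^(n+1) is increasing. *)
Lemma PSeries_lt_interpolation (y z : R) :
  0 < y < z -> ex_pseries a z ->
  PSeries a y
  < PS_partial_sum a n y + (y / z) ^ S n * (PSeries a z - PS_partial_sum a n z).
Proof.
intros Hyz Ez.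
assert (Ey : ex_pseries a y)
  by (apply (ex_pseries_Rabs_lt a y z); [rewrite !Rabs_pos_eq; lra|exact Ez]).
rewrite (PSeries_decr_n a n y Ey), (PSeries_decr_n a n z Ez).
fold (PS_partial_sum a n y) (PS_partial_sum a n z).
apply Rplus_lt_compat_l.
replace (y ^ S n) with ((y / z) ^ S n * z ^ S n)
  by (rewrite <- Rpow_mult_distr; f_equal; field; lra).
rewrite Rmult_assoc, (Rplus_comm (PS_partial_sum a n z)), Rplus_minus_r.
apply Rmult_lt_compat_l; [apply pow_lt, Rdiv_lt_0_compat; lra|].
apply Rmult_lt_compat_l; [apply pow_lt; lra|].
apply PSeries_increasing;
  [intros k; left; apply PS_decr_n_pos|apply PS_decr_n_pos|lra|].
now apply ex_pseries_decr_n_R.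
Qed.

End TruncatedPositiveSeries.

(** * Exponential, sine and cosine series *)

Definition exp_coef (a : R) (n : nat) : R := a ^ n / INR (fact n).

Lemma is_pseries_exp_coef (a t : R) : is_pseries (exp_coef a) t (exp (a * t)).
Proof.
pose proof (is_exp_Reals (a * t)) as H.
apply is_pseries_R in H; apply is_pseries_R.
revert H; apply is_series_ext; intros n.
unfold exp_coef; rewrite Rpow_mult_distr; unfold Rdiv.
change (/ INR (fact n) * (a ^ n * t ^ n)
        = a ^ n * / INR (fact n) * t ^ n).
ring.
Qed.

Lemma ex_pseries_sin_n (y : R) : ex_pseries sin_n y.
Proof.
destruct (exist_sin y) as [l Hl].
exists l; now apply is_pseries_R, is_series_Reals.
Qed.

Lemma ex_pseries_cos_n (y : R) : ex_pseries cos_n y.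
Proof.
destruct (exist_cos y) as [l Hl].
exists l; now apply is_pseries_R, is_series_Reals.
Qed.

Lemma CV_radius_sin_n : CV_radius sin_n = p_infty.
Proof. exact (CV_radius_infinite _ ex_pseries_sin_n). Qed.

Lemma CV_radius_cos_n : CV_radius cos_n = p_infty.
Proof. exact (CV_radius_infinite _ ex_pseries_cos_n). Qed.

Lemma sin_PSeries (x : R) : sin x = x * PSeries sin_n (x ^ 2).
Proof.
unfold sin; destruct (exist_sin (Rsqr x)) as [l Hl]; simpl.
f_equal; symmetry; apply is_pseries_unique, is_pseries_R, is_series_Reals.
now rewrite Rmult_1_r.
Qed.

Lemma cos_PSeries (x : R) : cos x = PSeries cos_n (x ^ 2).
Proof.
unfold cos; destruct (exist_cos (Rsqr x)) as [l Hl]; simpl.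
symmetry; apply is_pseries_unique, is_pseries_R, is_series_Reals.
now rewrite Rmult_1_r.
Qed.

Lemma sin_n_mult_odd (n : nat) : (2 * INR n + 1) * sin_n n = cos_n n.
Proof.
unfold sin_n, cos_n.
rewrite Nat.add_1_r, fact_simpl, mult_INR, S_INR, mult_INR; simpl (INR 2).
pose proof (pos_INR n).
field; split; [apply INR_fact_neq_0|lra].
Qed.

Lemma cos_n_S_mult_even (n : nat) : 2 * INR (S n) * cos_n (S n) = - sin_n n.
Proof.
unfold sin_n, cos_n.
replace (2 * S n)%nat with (S (2 * n + 1)) by lia.
rewrite fact_simpl, mult_INR, !S_INR, plus_INR, mult_INR.
simpl (INR 1); simpl (INR 2); rewrite <- tech_pow_Rmult.
pose proof (pos_INR n).
field; split; [apply INR_fact_neq_0|lra].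
Qed.

Lemma PSeries_derive_sin_n (y : R) :
  2 * y * PSeries (PS_derive sin_n) y = PSeries cos_n y - PSeries sin_n y.
Proof.
transitivity (PSeries (PS_scal 2 (PS_incr_1 (PS_derive sin_n))) y).
{ rewrite PSeries_scal, PSeries_incr_1; ring. }
rewrite <- PSeries_minus by (apply ex_pseries_cos_n || apply ex_pseries_sin_n).
apply PSeries_ext; intros n.
change (2 * PS_incr_1 (PS_derive sin_n) n = cos_n n - sin_n n).
rewrite PS_incr_1_derive, <- sin_n_mult_odd; ring.
Qed.

Lemma PSeries_derive_cos_n (y : R) :
  2 * PSeries (PS_derive cos_n) y = - PSeries sin_n y.
Proof.
rewrite <- PSeries_scal, <- PSeries_opp.
apply PSeries_ext; intros n.
change (2 * (INR (S n) * cos_n (S n)) = - sin_n n).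
rewrite <- cos_n_S_mult_even; ring.
Qed.

Lemma locally_PSeries_sin_n_neq_0 : locally 0 (fun y => PSeries sin_n y <> 0).
Proof.
assert (Hc : continuous (PSeries sin_n) 0).
{ apply continuity_pt_filterlim, PSeries_continuity.
  now rewrite CV_radius_sin_n. }
apply (Hc (fun s => s <> 0)).
rewrite PSeries_0.
apply open_neq; unfold sin_n; simpl; lra.
Qed.

(** * Bernoulli numbers *)

Lemma length_bern_upto (n : nat) : length (bern_upto n) = S n.
Proof.
induction n as [|n IH]; [reflexivity|].
cbn [bern_upto]; rewrite length_app, IH; simpl; lia.
Qed.

Lemma nth_bern_upto (k n : nat) :
  (k <= n)%nat -> nth k (bern_upto n) 0 = bernoulli k.
Proof.
induction n as [|n IH]; intros Hk.
- now replace k with 0%nat by lia.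
- destruct (Nat.eq_dec k (S n)) as [->|Hne]; [reflexivity|].
  cbn [bern_upto]; rewrite app_nth1 by (rewrite length_bern_upto; lia).
  apply IH; lia.
Qed.

Lemma bernoulli_S (n : nat) :
  bernoulli (S n)
  = - / (INR (S n) + 1) *
    sum_f_R0 (fun k => Binomial.C (S (S n)) k * bernoulli k) n.
Proof.
unfold bernoulli at 1; cbn [bern_upto].
rewrite app_nth2; rewrite length_bern_upto; [|lia].
rewrite Nat.sub_diag; cbn [nth].
f_equal; apply sum_eq; intros k Hk.
now rewrite nth_bern_upto by lia.
Qed.

Definition bernoulli_egf (n : nat) : R := bernoulli n / INR (fact n).

(* Coefficients of (e^t - 1) / t. *)
Definition expm1_div_coef (n : nat) : R := / INR (fact (S n)).

Lemma PS_mult_bernoulli_egf (n : nat) :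
  PS_mult bernoulli_egf expm1_div_coef n = PS_one n.
Proof.
destruct n as [|n].
- unfold PS_mult, bernoulli_egf, expm1_div_coef, bernoulli, PS_one; simpl; field.
- unfold PS_mult; rewrite tech5, Nat.sub_diag.
  unfold bernoulli_egf at 2; rewrite bernoulli_S.
  rewrite (sum_eq _ (fun k => (Binomial.C (S (S n)) k * bernoulli k)
                              * / INR (fact (S (S n))))).
  + rewrite <- scal_sum; unfold expm1_div_coef, PS_one.
    rewrite (fact_simpl (S n)), mult_INR, !S_INR.
    change (INR (fact 1)) with 1.
    pose proof (pos_INR n); field.
    split; [lra|apply INR_fact_neq_0].
  + intros k Hk; unfold bernoulli_egf, expm1_div_coef, Binomial.C.
    replace (S (S n) - k)%nat with (S (S n - k)) by lia.
    field; repeat split; apply INR_fact_neq_0.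
Qed.

Lemma Rabs_expm1_div_coef_le (n : nat) : Rabs (expm1_div_coef n) <= (/ 2) ^ n.
Proof.
unfold expm1_div_coef.
rewrite Rabs_pos_eq by (left; apply Rinv_0_lt_compat, INR_fact_lt_0).
rewrite pow_inv; apply Rinv_le_contravar; [apply pow_lt; lra|].
induction n as [|n IH]; [simpl; lra|].
rewrite fact_simpl, mult_INR, !S_INR; simpl pow.
pose proof (pos_INR n); pose proof (pow_lt 2 n); nra.
Qed.

Lemma Rabs_bernoulli_egf_le (n : nat) : Rabs (bernoulli_egf n) <= 1.
Proof.
replace 1 with ((2 * / 2) ^ n) by (rewrite Rinv_r, pow1; lra).
apply Rabs_PS_inverse_le with expm1_div_coef.
- unfold expm1_div_coef; simpl; field.
- exact Rabs_expm1_div_coef_le.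
- exact PS_mult_bernoulli_egf.
Qed.

Lemma CV_radius_bernoulli_egf (t : R) :
  Rabs t < 1 -> Rbar_lt (Rabs t) (CV_radius bernoulli_egf).
Proof.
intros Ht; apply Rbar_lt_le_trans with (Finite 1); [exact Ht|].
apply (CV_radius_ge_of_bounded _ _ 1); intros n.
rewrite pow1, Rmult_1_r; apply Rabs_bernoulli_egf_le.
Qed.

Lemma PSeries_expm1_div_coef (t : R) : t * PSeries expm1_div_coef t = exp t - 1.
Proof.
pose proof (is_exp_Reals t) as H.
rewrite <- (is_pseries_unique _ _ _ H).
rewrite (PSeries_decr_1 (fun n => / INR (fact n))) by (now exists (exp t)).
change (t * PSeries expm1_div_coef t
        = / 1 + t * PSeries expm1_div_coef t - 1); field.
Qed.

Lemma PSeries_bernoulli_egf (t : R) :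
  Rabs t < 1 -> PSeries bernoulli_egf t * (exp t - 1) = t.
Proof.
intros Ht.
assert (radius_expm1 : Rbar_lt (Rabs t) (CV_radius expm1_div_coef)).
{ apply Rbar_lt_le_trans with (Finite 1); [exact Ht|].
  apply (CV_radius_ge_of_bounded _ _ 1); intros n.
  rewrite pow1, Rmult_1_r.
  apply Rle_trans with (1 := Rabs_expm1_div_coef_le n).
  rewrite <- (pow1 n); apply pow_incr; lra. }
rewrite <- PSeries_expm1_div_coef.
transitivity (t * (PSeries bernoulli_egf t * PSeries expm1_div_coef t)); [ring|].
rewrite <- PSeries_mult by (assumption || now apply CV_radius_bernoulli_egf).
rewrite (PSeries_ext _ _ _ PS_mult_bernoulli_egf).
rewrite (is_pseries_unique _ _ _ (is_pseries_one t)); ring.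
Qed.

(* Coefficients of e^(t/2) - e^(-t/2). *)
Definition two_sinh_half_coef : nat -> R :=
  PS_minus (exp_coef (/ 2)) (exp_coef (- / 2)).

Lemma is_pseries_two_sinh_half_coef (t : R) :
  is_pseries two_sinh_half_coef t (exp (/ 2 * t) - exp (- / 2 * t)).
Proof.
apply (is_pseries_minus (V := R_NormedModule)); apply is_pseries_exp_coef.
Qed.

Lemma two_sinh_half_coef_even (k : nat) : two_sinh_half_coef (2 * k) = 0.
Proof.
change (exp_coef (/ 2) (2 * k) - exp_coef (- / 2) (2 * k) = 0).
unfold exp_coef; rewrite !pow_mult.
replace ((- / 2) ^ 2) with ((/ 2) ^ 2) by ring; ring.
Qed.

Lemma two_sinh_half_coef_odd (k : nat) :
  (-4) ^ k * two_sinh_half_coef (S (2 * k)) = sin_n k.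
Proof.
change ((-4) ^ k * (exp_coef (/ 2) (S (2 * k)) - exp_coef (- / 2) (S (2 * k)))
        = sin_n k).
unfold exp_coef, sin_n; rewrite <- !tech_pow_Rmult, !pow_mult, Nat.add_1_r.
replace ((- / 2) ^ 2) with (/ 4) by field.
replace ((/ 2) ^ 2) with (/ 4) by field.
replace ((-1) ^ k) with ((-4) ^ k * (/ 4) ^ k)
  by (rewrite <- Rpow_mult_distr; f_equal; field).
field; apply INR_fact_neq_0.
Qed.

(* (t / (e^t - 1)) (e^(t/2) - e^(-t/2)) = t e^(-t/2). *)
Lemma PS_mult_bernoulli_egf_two_sinh_half_coef (n : nat) :
  PS_mult bernoulli_egf two_sinh_half_coef n = PS_incr_1 (exp_coef (- / 2)) n.
Proof.
assert (near_0 : locally 0 (fun t => Rabs t < 1)).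
{ exists (mkposreal 1 Rlt_0_1); intros t Ht.
  change (Rabs (t - 0) < 1) in Ht; now rewrite Rminus_0_r in Ht. }
apply is_pseries_coef_unique with (fun t => t * exp (- / 2 * t)).
- revert near_0; apply filter_imp; intros t Ht.
  replace (t * exp (- / 2 * t))
    with (PSeries bernoulli_egf t * (exp (/ 2 * t) - exp (- / 2 * t))).
  + apply is_pseries_mult.
    * now apply PSeries_correct, CV_radius_inside, CV_radius_bernoulli_egf.
    * apply is_pseries_two_sinh_half_coef.
    * now apply CV_radius_bernoulli_egf.
    * rewrite (CV_radius_infinite two_sinh_half_coef); [exact I|].
      intros s; eexists; apply is_pseries_two_sinh_half_coef.
  + transitivity (PSeries bernoulli_egf t * (exp t - 1) * exp (- / 2 * t));
      [|now rewrite PSeries_bernoulli_egf].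
    replace (exp t) with (exp (/ 2 * t) * exp (/ 2 * t))
      by (rewrite <- exp_plus; f_equal; field).
    rewrite Ropp_mult_distr_l_reverse, exp_Ropp.
    field; apply Rgt_not_eq, exp_pos.
- apply filter_forall; intros t.
  apply (is_pseries_incr_1 (V := R_NormedModule)), is_pseries_exp_coef.
Qed.

(** * The cotangent series *)

(* Coefficients of x cot x as a power series in x^2: substitute t = 2 i x in
   t / (e^t - 1) and keep the even part. *)
Definition cot_coef (k : nat) : R := (-4) ^ k * bernoulli_egf (2 * k).

Lemma PS_mult_cot_coef_sin_n (n : nat) : PS_mult cot_coef sin_n n = cos_n n.
Proof.
pose proof (PS_mult_bernoulli_egf_two_sinh_half_coef (S (2 * n))) as H.
unfold PS_mult in *; rewrite sum_f_R0_even_terms in H.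
- transitivity ((-4) ^ n * PS_incr_1 (exp_coef (- / 2)) (S (2 * n))).
  + rewrite <- H, scal_sum; apply sum_eq; intros k Hk.
    replace (S (2 * n) - 2 * k)%nat with (S (2 * (n - k))) by lia.
    rewrite <- two_sinh_half_coef_odd; unfold cot_coef.
    replace ((-4) ^ n) with ((-4) ^ k * (-4) ^ (n - k))
      by (rewrite <- pow_add; f_equal; lia).
    ring.
  + change ((-4) ^ n * exp_coef (- / 2) (2 * n) = cos_n n).
    unfold exp_coef, cos_n; rewrite pow_mult.
    unfold Rdiv; rewrite <- Rmult_assoc, <- Rpow_mult_distr.
    do 2 f_equal; field.
- intros k; replace (S (2 * n) - S (2 * k))%nat with (2 * (n - k))%nat by lia.
  rewrite two_sinh_half_coef_even; ring.
Qed.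

Lemma PSeries_cot_coef_mult_sin_n (y : R) :
  Rbar_lt (Rabs y) (CV_radius cot_coef) ->
  PSeries cot_coef y * PSeries sin_n y = PSeries cos_n y.
Proof.
intros Hy; rewrite <- PSeries_mult; [|exact Hy|now rewrite CV_radius_sin_n].
apply PSeries_ext, PS_mult_cot_coef_sin_n.
Qed.

Lemma CV_radius_cot_coef_pos : Rbar_lt 0 (CV_radius cot_coef).
Proof.
apply Rbar_lt_le_trans with (Finite (/ 4)); [simpl; lra|].
apply (CV_radius_ge_of_bounded _ _ 1); intros n.
unfold cot_coef.
replace ((-4) ^ n * bernoulli_egf (2 * n) * (/ 4) ^ n)
  with ((-1) ^ n * bernoulli_egf (2 * n)).
- rewrite Rabs_mult, pow_1_abs, Rmult_1_l; apply Rabs_bernoulli_egf_le.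
- replace ((-1) ^ n) with ((-4) ^ n * (/ 4) ^ n); [ring|].
  rewrite <- Rpow_mult_distr; f_equal; field.
Qed.

(* Differentiate cot_coef * sin_n = cos_n, eliminate cos_n and divide by sin_n. *)
Lemma PSeries_cot_coef_ode (y : R) :
  Rbar_lt (Rabs y) (CV_radius cot_coef) -> PSeries sin_n y <> 0 ->
  2 * y * PSeries (PS_derive cot_coef) y + PSeries cot_coef y ^ 2
  = PSeries cot_coef y - y.
Proof.
intros Hy Hs.
set (U := PSeries cot_coef y); set (U' := PSeries (PS_derive cot_coef) y).
set (V := PSeries sin_n y) in *; set (V' := PSeries (PS_derive sin_n) y).
assert (derivative_identity : U' * V + U * V' = PSeries (PS_derive cos_n) y).
{ transitivity (Derive (fun t => PSeries cot_coef t * PSeries sin_n t) y).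
  - symmetry; apply is_derive_unique.
    evar_last; [apply (is_derive_mult (PSeries cot_coef) (PSeries sin_n) y)|].
    + now apply is_derive_PSeries.
    + apply is_derive_PSeries; now rewrite CV_radius_sin_n.
    + exact Rmult_comm.
    + reflexivity.
  - rewrite <- Derive_PSeries by now rewrite CV_radius_cos_n.
    apply Derive_ext_loc; generalize (locally_lt_CV_radius _ _ Hy).
    apply filter_imp; exact PSeries_cot_coef_mult_sin_n. }
pose proof (PSeries_derive_sin_n y) as HV'; fold V V' in HV'.
pose proof (PSeries_derive_cos_n y) as HC'; fold V in HC'.
pose proof (PSeries_cot_coef_mult_sin_n y Hy) as HUV; fold V U in HUV.
apply Rmult_eq_reg_r with V; [|exact Hs].
rewrite <- HUV in HV'; rewrite <- derivative_identity in HC'.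
transitivity (y * (2 * (U' * V + U * V')) - U * (2 * y * V') + U ^ 2 * V).
- ring.
- rewrite HC', HV'; ring.
Qed.

Lemma cot_coef_rec (n : nat) :
  2 * INR n * cot_coef n + PS_mult cot_coef cot_coef n
  = cot_coef n - PS_incr_1 PS_one n.
Proof.
transitivity (PS_plus (PS_scal 2 (PS_incr_1 (PS_derive cot_coef)))
                (PS_mult cot_coef cot_coef) n).
{ change (2 * INR n * cot_coef n + PS_mult cot_coef cot_coef n
          = 2 * PS_incr_1 (PS_derive cot_coef) n + PS_mult cot_coef cot_coef n).
  rewrite PS_incr_1_derive; ring. }
change (cot_coef n - PS_incr_1 PS_one n)
  with (PS_minus cot_coef (PS_incr_1 PS_one) n).
assert (near_0 : locally 0 (fun y =>
  Rbar_lt (Rabs y) (CV_radius cot_coef) /\ PSeries sin_n y <> 0)).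
{ apply filter_and; [|exact locally_PSeries_sin_n_neq_0].
  apply locally_lt_CV_radius; rewrite Rabs_R0; exact CV_radius_cot_coef_pos. }
apply is_pseries_coef_unique with (fun y => PSeries cot_coef y - y);
  revert near_0; apply filter_imp; intros y [Hy Hs];
  pose proof (PSeries_correct _ _ (CV_radius_inside _ _ Hy)) as HU.
- rewrite <- PSeries_cot_coef_ode by assumption.
  evar_last.
  + apply (is_pseries_plus (V := R_NormedModule)).
    * apply (is_pseries_scal (V := R_NormedModule)); [apply Rmult_comm|].
      apply (is_pseries_incr_1 (V := R_NormedModule)), PSeries_correct.
      now apply ex_pseries_derive.
    * apply is_pseries_mult; [exact HU|exact HU|exact Hy|exact Hy].
  + unfold plus, scal; simpl; unfold mult; simpl; ring.
- evar_last.
  + apply (is_pseries_minus (V := R_NormedModule)); [exact HU|].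
    apply (is_pseries_incr_1 (V := R_NormedModule)), is_pseries_one.
  + unfold plus, opp, scal; simpl; unfold mult; simpl; ring.
Qed.

Lemma cot_coef_0 : cot_coef 0 = 1.
Proof. unfold cot_coef, bernoulli_egf, bernoulli; simpl; field. Qed.

Lemma cot_coef_1 : cot_coef 1 = - / 3.
Proof.
pose proof (cot_coef_rec 1) as H; unfold PS_mult in H; simpl in H.
rewrite cot_coef_0 in H; lra.
Qed.

Lemma cot_coef_SS (n : nat) :
  (2 * INR n + 5) * - cot_coef (S (S n))
  = sum_f_R0 (fun k => - cot_coef (S k) * - cot_coef (S (n - k))) n.
Proof.
pose proof (cot_coef_rec (S (S n))) as H.
rewrite PS_mult_self_SS, cot_coef_0, !S_INR in H.
unfold PS_mult, PS_decr_1 in H; simpl (PS_incr_1 PS_one _) in H.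
rewrite (sum_eq _ (fun k => cot_coef (S k) * cot_coef (S (n - k))))
  by (intros; ring).
lra.
Qed.

Lemma cot_coef_S_neg (n : nat) : 0 < - cot_coef (S n).
Proof.
induction n as [n IH] using lt_wf_ind.
destruct n as [|n]; [rewrite cot_coef_1; lra|].
pose proof (pos_INR n).
apply Rmult_lt_reg_l with (2 * INR n + 5); [lra|].
rewrite Rmult_0_r, cot_coef_SS.
apply tech1; intros k Hk.
apply Rmult_lt_0_compat; apply IH; lia.
Qed.

Lemma cot_coef_S_le (n : nat) : - cot_coef (S n) <= / 3 * (/ 6) ^ n.
Proof.
induction n as [n IH] using lt_wf_ind.
destruct n as [|n]; [rewrite cot_coef_1; simpl; lra|].
pose proof (pos_INR n) as Hn.
apply Rmult_le_reg_l with (2 * INR n + 5); [lra|].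
rewrite cot_coef_SS.
apply Rle_trans with (sum_f_R0 (fun _ => / 9 * (/ 6) ^ n) n).
- apply sum_Rle; intros k Hk.
  replace (/ 9 * (/ 6) ^ n) with ((/ 3 * (/ 6) ^ k) * (/ 3 * (/ 6) ^ (n - k))).
  + apply Rmult_le_compat;
      solve [left; apply cot_coef_S_neg | apply IH; lia].
  + replace ((/ 6) ^ n) with ((/ 6) ^ k * (/ 6) ^ (n - k))
      by (rewrite <- pow_add; f_equal; lia).
    field; repeat split; try lra; apply pow_nonzero; lra.
- rewrite sum_cte, S_INR; simpl pow.
  pose proof (pow_lt (/ 6) n); nra.
Qed.

Lemma CV_radius_cot_coef_ge_6 : Rbar_le 6 (CV_radius cot_coef).
Proof.
apply (CV_radius_ge_of_bounded _ _ 2).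
intros [|n]; [rewrite cot_coef_0; simpl; rewrite Rabs_pos_eq; lra|].
assert (0 < 6 ^ n) by (apply pow_lt; lra).
rewrite Rabs_mult, <- Rabs_Ropp, !Rabs_pos_eq
  by (left; apply cot_coef_S_neg || (apply pow_lt; lra)).
apply Rle_trans with (/ 3 * (/ 6) ^ n * 6 ^ S n).
- apply Rmult_le_compat_r; [left; apply pow_lt; lra|apply cot_coef_S_le].
- rewrite pow_inv; simpl; right; field; lra.
Qed.

Lemma lt_CV_radius_cot_coef (x : R) :
  x ^ 2 < 6 -> Rbar_lt (Rabs (x ^ 2)) (CV_radius cot_coef).
Proof.
intros Hx; apply Rbar_lt_le_trans with (2 := CV_radius_cot_coef_ge_6).
simpl Rbar_lt; rewrite Rabs_pos_eq; [exact Hx|apply pow2_ge_0].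
Qed.

Lemma PSeries_cot_coef_mult_sin (x : R) :
  x ^ 2 < 6 -> PSeries cot_coef (x ^ 2) * sin x = x * cos x.
Proof.
intros Hx; rewrite sin_PSeries, cos_PSeries.
rewrite <- PSeries_cot_coef_mult_sin_n by now apply lt_CV_radius_cot_coef.
ring.
Qed.

Lemma cot_coef_ratio (n : nat) :
  (0 < n)%nat -> - cot_coef n <= 3 * (2 * INR n + 3) * - cot_coef (S n).
Proof.
intros Hn; destruct n as [|n]; [lia|].
pose proof (cot_coef_SS n) as H; rewrite S_INR.
assert (first_term : / 3 * - cot_coef (S n)
  <= sum_f_R0 (fun k => - cot_coef (S k) * - cot_coef (S (n - k))) n).
{ destruct n as [|n]; [simpl; rewrite cot_coef_1; lra|].
  rewrite decomp_sum, Nat.sub_0_r, cot_coef_1, Ropp_involutive by lia.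
  apply Rplus_le_reg_l with (- (/ 3 * - cot_coef (S (S n)))).
  rewrite <- Rplus_assoc, Rplus_opp_l, Rplus_0_l.
  apply cond_pos_sum; intros k.
  left; apply Rmult_lt_0_compat; apply cot_coef_S_neg. }
lra.
Qed.

Lemma inv_fact_le_cot_coef (k : nat) :
  (3 <= k)%nat -> / INR (fact (2 * k)) <= 3 / 2 * - cot_coef k.
Proof.
induction 1 as [|k Hk IH].
- pose proof (cot_coef_SS 0) as rec_2; pose proof (cot_coef_SS 1) as rec_3.
  simpl in rec_2, rec_3; rewrite cot_coef_1 in rec_2, rec_3.
  replace (INR (fact (2 * 3))) with 720 by (rewrite INR_IZR_INZ; reflexivity).
  lra.
- pose proof (cot_coef_ratio k ltac:(lia)) as Hratio.
  pose proof (cot_coef_S_neg k) as Hpos.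
  assert (3 <= INR k) by (apply (le_INR 3) in Hk; simpl in Hk; lra).
  set (Q := (2 * INR k + 2) * (2 * INR k + 1)).
  assert (HQ : 3 * (2 * INR k + 3) <= Q) by (unfold Q; nra).
  assert (Hfact : INR (fact (2 * S k)) = Q * INR (fact (2 * k))).
  { replace (2 * S k)%nat with (S (S (2 * k))) by lia.
    rewrite !fact_simpl, !mult_INR, !S_INR, mult_INR; simpl (INR 2).
    unfold Q; ring. }
  rewrite Hfact, Rinv_mult.
  apply Rmult_le_reg_l with Q; [lra|].
  rewrite <- Rmult_assoc, Rinv_r, Rmult_1_l by lra.
  apply Rle_trans with (1 := IH); nra.
Qed.

(** * The series of 3 x / sin x + cos x *)

(* Coefficients of x / sin x as a power series in x^2, from
   x / sin x = 2 (x / 2) cot (x / 2) - x cot x. *)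
Definition csc_coef (k : nat) : R := 2 * (cot_coef k / 4 ^ k) - cot_coef k.

Lemma div_sin_eq (x : R) :
  x ^ 2 < 6 -> sin x <> 0 ->
  x / sin x = 2 * PSeries cot_coef ((x / 2) ^ 2) - PSeries cot_coef (x ^ 2).
Proof.
intros Hx Hs.
pose proof (PSeries_cot_coef_mult_sin x Hx) as at_x.
assert (at_half : PSeries cot_coef ((x / 2) ^ 2) * sin (x / 2)
                  = x / 2 * cos (x / 2))
  by (apply PSeries_cot_coef_mult_sin; nra).
assert (double : sin x = 2 * sin (x / 2) * cos (x / 2))
  by (rewrite <- sin_2a; f_equal; field).
assert (cos_double : cos x = 2 * cos (x / 2) * cos (x / 2) - 1)
  by (rewrite <- cos_2a_cos; f_equal; field).
apply Rmult_eq_reg_r with (sin x); [|exact Hs].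
rewrite Rmult_minus_distr_r, at_x, cos_double.
transitivity x; [now field|].
transitivity (4 * (PSeries cot_coef ((x / 2) ^ 2) * sin (x / 2)) * cos (x / 2)
              - x * (2 * cos (x / 2) * cos (x / 2) - 1)).
- rewrite at_half; field.
- rewrite double; ring.
Qed.

Lemma is_pseries_csc_coef (x : R) :
  x ^ 2 < 6 -> sin x <> 0 -> is_pseries csc_coef (x ^ 2) (x / sin x).
Proof.
intros Hx Hs; rewrite div_sin_eq by assumption.
assert (at_radius : forall t, t ^ 2 < 6 ->
  is_pseries cot_coef (t ^ 2) (PSeries cot_coef (t ^ 2)))
  by (intros t Ht; now apply PSeries_correct, CV_radius_inside,
        lt_CV_radius_cot_coef).
apply (is_pseries_minus (V := R_NormedModule) (fun k => 2 * (cot_coef k / 4 ^ k))).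
- apply (is_pseries_scal (V := R_NormedModule) 2); [apply Rmult_comm|].
  assert (Hhalf : (x / 2) ^ 2 < 6) by nra.
  pose proof (at_radius _ Hhalf) as H; apply is_pseries_R in H.
  apply is_pseries_R; revert H; apply is_series_ext; intros n.
  replace ((x / 2) ^ 2) with (x ^ 2 * / 4) by field.
  rewrite Rpow_mult_distr, pow_inv; unfold Rdiv.
  change (cot_coef n * ((x ^ 2) ^ n * / 4 ^ n)
          = cot_coef n * / 4 ^ n * (x ^ 2) ^ n).
  ring.
- now apply at_radius.
Qed.

Lemma half_cot_coef_lt_csc_coef (k : nat) :
  (1 < k)%nat -> / 2 * - cot_coef k < csc_coef k.
Proof.
intros Hk.
assert (0 < - cot_coef k)
  by (replace k with (S (k - 1)) by lia; apply cot_coef_S_neg).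
assert (4 < 4 ^ k) by (rewrite <- (pow_1 4) at 1; apply Rlt_pow; [lra|lia]).
assert (/ 4 ^ k < / 4) by (apply Rinv_lt_contravar; lra).
unfold csc_coef, Rdiv; nra.
Qed.

Lemma Rabs_bernoulli_even (k : nat) :
  (0 < k)%nat ->
  Rabs (bernoulli (2 * k)) / INR (fact (2 * k)) = - cot_coef k / 4 ^ k.
Proof.
intros Hk; destruct k as [|k]; [lia|].
pose proof (INR_fact_lt_0 (2 * S k)).
rewrite <- Rabs_left by (pose proof (cot_coef_S_neg k); lra).
unfold cot_coef, bernoulli_egf.
rewrite Rabs_mult, <- RPow_abs, Rabs_div by lra.
rewrite (Rabs_pos_eq (INR _)) by lra.
replace (Rabs (-4)) with 4 by (rewrite Rabs_left; lra).
field; split; [lra|apply pow_nonzero; lra].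
Qed.

Definition csc_cos_coef (k : nat) : R := 3 * csc_coef k + cos_n k.

Lemma is_pseries_csc_cos_coef (x : R) :
  x ^ 2 < 6 -> sin x <> 0 ->
  is_pseries csc_cos_coef (x ^ 2) (3 * (x / sin x) + cos x).
Proof.
intros Hx Hs.
apply (is_pseries_plus (V := R_NormedModule) (fun k => 3 * csc_coef k)).
- apply (is_pseries_scal (V := R_NormedModule) 3); [apply Rmult_comm|].
  now apply is_pseries_csc_coef.
- rewrite cos_PSeries; apply PSeries_correct, ex_pseries_cos_n.
Qed.

Lemma csc_cos_coef_pos (k : nat) : (3 <= k)%nat -> 0 < csc_cos_coef k.
Proof.
intros Hk; unfold csc_cos_coef.
pose proof (half_cot_coef_lt_csc_coef k ltac:(lia)).
pose proof (inv_fact_le_cot_coef k Hk).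
assert (- / INR (fact (2 * k)) <= cos_n k); [|lra].
pose proof (Rinv_0_lt_compat _ (INR_fact_lt_0 (2 * k))).
pose proof (Rle_abs (- (-1) ^ k)) as Hsign.
rewrite Rabs_Ropp, pow_1_abs in Hsign.
unfold cos_n, Rdiv; nra.
Qed.

Lemma c_eq (k : nat) : (0 < k)%nat -> c k = csc_cos_coef k.
Proof.
intros Hk; unfold c, csc_cos_coef, csc_coef, cos_n.
transitivity (3 * (Rabs (bernoulli (2 * k)) / INR (fact (2 * k)))
              * (2 ^ (2 * k) - 2) + (-1) ^ k / INR (fact (2 * k))).
- field; apply INR_fact_neq_0.
- rewrite Rabs_bernoulli_even, pow_mult by exact Hk.
  replace (2 ^ 2) with 4 by ring.
  field; split; [apply INR_fact_neq_0|apply pow_nonzero; lra].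
Qed.

Lemma csum_eq (n : nat) (x : R) :
  4 + csum n x = PS_partial_sum csc_cos_coef n (x ^ 2).
Proof.
induction n as [|n IH].
- unfold PS_partial_sum, csc_cos_coef, csc_coef, cos_n; simpl.
  rewrite cot_coef_0; field.
- unfold PS_partial_sum in *; rewrite tech5, <- IH; cbn [csum].
  rewrite c_eq, (pow_mult x 2) by lia; ring.
Qed.

Lemma sq_lt_6_of_le_PI2 (x : R) : 0 < x <= PI / 2 -> x ^ 2 < 6.
Proof. pose proof PI_4; nra. Qed.

Theorem theorem6 (x : R) (m : nat) :
  0 < x < PI / 2 -> (3 <= m)%nat ->
  4 + csum (m - 1) x
    + (2 * x / PI) ^ (2 * m) * (3 * PI / 2 - 4 - csum (m - 1) (PI / 2))
    > 3 * (x / sin x) + cos x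
  /\ 3 * (x / sin x) + cos x > 4 + csum m x.
Proof.
intros Hx Hm; pose proof PI_RGT_0.
assert (series : forall t, 0 < t <= PI / 2 ->
  is_pseries csc_cos_coef (t ^ 2) (3 * (t / sin t) + cos t)).
{ intros t Ht; apply is_pseries_csc_cos_coef; [now apply sq_lt_6_of_le_PI2|].
  apply Rgt_not_eq, sin_gt_0; lra. }
pose proof (series x ltac:(lra)) as series_x.
pose proof (series (PI / 2) ltac:(lra)) as series_PI2.
rewrite sin_PI2, cos_PI2 in series_PI2.
rewrite <- (is_pseries_unique _ _ _ series_x); split.
- replace (3 * PI / 2 - 4 - csum (m - 1) (PI / 2))
    with (PSeries csc_cos_coef ((PI / 2) ^ 2) - (4 + csum (m - 1) (PI / 2)))
    by (rewrite (is_pseries_unique _ _ _ series_PI2); field).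
  replace ((2 * x / PI) ^ (2 * m)) with ((x ^ 2 / (PI / 2) ^ 2) ^ S (m - 1))
    by (rewrite pow_mult; f_equal; [field; lra|lia]).
  rewrite !csum_eq; apply PSeries_lt_interpolation.
  + intros k Hk; apply csc_cos_coef_pos; lia.
  + split; nra.
  + eexists; exact series_PI2.
- rewrite csum_eq; apply PS_partial_sum_lt_PSeries.
  + intros k Hk; apply csc_cos_coef_pos; lia.
  + apply pow_lt; lra.
  + eexists; exact series_x.
Qed.
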